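(* Let $u:\mathbb{R}^n\to\mathbb{R}$ be a smooth function and let $M$ be its (entire) graph in $\mathbb{R}^{n+1}$. Assume its mean curvature $H=-\operatorname{div}\big(Du/\sqrt{1+|Du|^2}\big)$ is non-positive on $\mathbb{R}^n$. Then there is a constant $C>0$ such that $\operatorname{vol}(B_R\cap M)\le CR^n$, where $B_R=\{X\in\mathbb{R}^{n+1}:|X|<R\}$. Furthermore, if such a graph $M$ is a translating soliton, i.e. $H=\langle\nu,a\rangle$ for a fixed unit vector $a\in\mathbb{R}^{n+1}$ with $\nu=(-Du,1)/\sqrt{1+|Du|^2}$, then, with $S(X)=\langle X,a\rangle$ on $M$, either $\inf_M S=-\infty$ or $\sup_M S=\infty$.
   Context: Volume on $M$ is the induced $n$-dimensional Riemannian volume; $Du$ is the Euclidean gradient of $u$. *)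

(* Defs.v *)
From HB Require Import structures.
From mathcomp Require Import all_boot all_order all_algebra.
From mathcomp Require Import all_classical all_reals all_analysis.
Set Implicit Arguments. Unset Strict Implicit. Unset Printing Implicit Defensive.
Import Order.TTheory GRing.Theory Num.Theory.
Import numFieldNormedType.Exports.
Local Open Scope ring_scope.

Definition dotp (R : realType) (m : nat) (X Y : 'rV[R]_m) : R :=
  \sum_(i < m) X ord0 i * Y ord0 i.

Definition ebase (R : realType) (n : nat) (i : 'I_n) : 'rV[R]_n := delta_mx ord0 i.

Definition pd (R : realType) (n : nat) (i : 'I_n) (f : 'rV[R]_n -> R)
  : 'rV[R]_n -> R := fun x => 'D_(ebase R i) f x.

Fixpoint iterpd (R : realType) (n : nat) (l : seq 'I_n) (f : 'rV[R]_n -> R)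
  : 'rV[R]_n -> R :=
  match l with [::] => f | i :: l' => pd i (iterpd l' f) end.

Definition smooth (R : realType) (n : nat) (f : 'rV[R]_n -> R) : Prop :=
  forall (l : seq 'I_n) (x : 'rV[R]_n),
    {for x, continuous (iterpd l f)} /\
    forall i : 'I_n, derivable (iterpd l f) x (ebase R i).

Definition grad (R : realType) (n : nat) (u : 'rV[R]_n -> R) (x : 'rV[R]_n)
  : 'rV[R]_n := \row_(i < n) pd i u x.

Definition Wfac (R : realType) (n : nat) (u : 'rV[R]_n -> R) (x : 'rV[R]_n) : R :=
  Num.sqrt (1 + dotp (grad u x) (grad u x)).

Definition mean_curv (R : realType) (n : nat) (u : 'rV[R]_n -> R) (x : 'rV[R]_n) : R :=
  - \sum_(i < n) pd i (fun y => pd i u y / Wfac u y) x.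

Definition graphpt (R : realType) (n : nat) (u : 'rV[R]_n -> R) (x : 'rV[R]_n)
  : 'rV[R]_(n + 1) := row_mx x (u x)%:M.

Definition normal (R : realType) (n : nat) (u : 'rV[R]_n -> R) (x : 'rV[R]_n)
  : 'rV[R]_(n + 1) := (Wfac u x)^-1 *: row_mx (- grad u x) (1%:M).

(* induced metric of the graph in the global chart x |-> (x, u x):
   g_ij = delta_ij + d_i u d_j u *)
Definition graph_metric (R : realType) (n : nat) (u : 'rV[R]_n -> R) (x : 'rV[R]_n)
  : 'M[R]_n := 1%:M + (grad u x)^T *m grad u x.

(* Lebesgue integral over R^n of a nonnegative function, as iterated
   one-dimensional Lebesgue integrals (Tonelli). *)
Fixpoint iterint (R : realType) (n : nat) : ('rV[R]_n -> \bar R) -> \bar R :=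
  match n return ('rV[R]_n -> \bar R) -> \bar R with
  | 0 => fun f => f 0
  | k.+1 => fun f =>
      (\int[@lebesgue_measure R]_t
         iterint (fun v : 'rV[R]_k =>
           f (\row_(i < k.+1) match unlift ord0 i with
                              | Some j => v ord0 j
                              | None => t end)))%E
  end.

(* Riemannian volume of B_R \cap M, B_R = {X in R^(n+1) : |X| < R},
   computed in the global chart: \int_{x : |(x,u x)| < R} sqrt(det g) dx *)
Definition graph_ball_vol (R : realType) (n : nat) (u : 'rV[R]_n -> R) (r : R)
  : \bar R :=
  iterint (fun x : 'rV[R]_n =>
    (if dotp (graphpt u x) (graphpt u x) < r ^+ 2
     then Num.sqrt (\det (graph_metric u x)) else 0)%:E).

(* Main.v *)
(* The vector field V = Du / W, W = sqrt (1 + |Du|^2), satisfies |V| <= 1,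
   div V = - H >= 0 and <V, Du> = W - 1/W.  For a cutoff eta of the cube
   [-L, L]^n and an increasing ramp 0 <= T <= 2 pi P with T' >= 1 on [-P, P],
     div (eta T(u) V) >= eta T'(u) <V, Du> - T(u) |D eta|,
   and integrating over the cube bounds the integral of eta W over {|u| <= P} by
   (1 + O(P / L)) (2L)^n; L = 2R and P = R give the volume growth.
   For a translating soliton, |grad S|^2 = 1 - H^2 and Delta S = - H^2 on M, so
   Delta (exp (- S)) = exp (- S).  If S were bounded, u would grow at most
   linearly; integrating eta^2 Delta (exp (- S)) over the cube by parts would
   give L^n <= O(1/L) * (integral of eta W) = O(L^(n-1)), which fails for large L. *)
Require Import Defs.
From HB Require Import structures.
From mathcomp Require Import all_boot all_order all_algebra.
From mathcomp Require Import all_classical all_reals all_analysis.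
From mathcomp Require Import ring lra.
Import Order.TTheory GRing.Theory Num.Theory.
Import numFieldNormedType.Exports.
Local Open Scope classical_set_scope.
Local Open Scope ring_scope.

(** * Continuity of sums, products and inverses of real functions *)

Section Continuity.
Context {R : realType} {T : topologicalType}.
Implicit Types f g : T -> R.

Lemma rcontinuous_cst (c : R) : continuous (fun _ : T => c).
Proof. by move=> x; exact: cvg_cst. Qed.

Lemma rcontinuousD f g : continuous f -> continuous g ->
  continuous (fun x => f x + g x).
Proof. by move=> cf cg x; apply: continuousD; [exact: cf|exact: cg]. Qed.

Lemma rcontinuousN f : continuous f -> continuous (fun x => - f x).
Proof. by move=> cf x; apply: continuousN; exact: cf. Qed.

Lemma rcontinuousM f g : continuous f -> continuous g ->
  continuous (fun x => f x * g x).
Proof. by move=> cf cg x; apply: continuousM; [exact: cf|exact: cg]. Qed.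

Lemma rcontinuousV f : continuous f -> (forall x, f x != 0) ->
  continuous (fun x => (f x)^-1).
Proof. by move=> cf f0 x; apply: cvgV; [exact: f0|exact: cf]. Qed.

Lemma rcontinuous_sum (I : Type) (s : seq I) (P : pred I) (F : I -> T -> R) :
  (forall i, continuous (F i)) -> continuous (fun x => \sum_(i <- s | P i) F i x).
Proof.
move=> cF; elim: s => [|i s IH].
  rewrite (_ : (fun _ => _) = fun=> 0); first exact: rcontinuous_cst.
  by apply/funext => x; rewrite big_nil.
rewrite (_ : (fun _ => _) = fun x => if P i
  then F i x + \sum_(i <- s | P i) F i x else \sum_(i <- s | P i) F i x).
  by case: (P i) => //; exact: rcontinuousD.
by apply/funext => x; rewrite big_cons.
Qed.

Lemma rcontinuous_prod (I : Type) (s : seq I) (P : pred I) (F : I -> T -> R) :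
  (forall i, continuous (F i)) -> continuous (fun x => \prod_(i <- s | P i) F i x).
Proof.
move=> cF; elim: s => [|i s IH].
  rewrite (_ : (fun _ => _) = fun=> 1); first exact: rcontinuous_cst.
  by apply/funext => x; rewrite big_nil.
rewrite (_ : (fun _ => _) = fun x => if P i
  then F i x * \prod_(i <- s | P i) F i x else \prod_(i <- s | P i) F i x).
  by case: (P i) => //; exact: rcontinuousM.
by apply/funext => x; rewrite big_cons.
Qed.

End Continuity.

(** * Integration over cubes *)

Section BoxIntegral.
Context {R : realType}.
Implicit Types (L t : R) (n k : nat).

(* The slicing of R^(k+1) used by [iterint]. *)
Definition consv {k} t (v : 'rV[R]_k) : 'rV[R]_k.+1 :=
  \row_(i < k.+1) match unlift ord0 i with Some j => v ord0 j | None => t end.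

Definition inbox {n} L (x : 'rV[R]_n) : Prop := forall i, `|x ord0 i| <= L.

(** Real-valued and sliced in the same order as [iterint]: integrals over cubes can be added and
    differentiated without infinities and compared with [iterint] slice by slice. *)
Fixpoint boxint L n : ('rV[R]_n -> R) -> R :=
  match n return ('rV[R]_n -> R) -> R with
  | 0 => fun f => f 0
  | k.+1 => fun f =>
     \int[lebesgue_measure]_(t in `[- L, L]) boxint L k (fun v => f (consv t v))
  end.

Lemma consv0 k t (v : 'rV[R]_k) : consv t v ord0 ord0 = t.
Proof. by rewrite mxE unlift_none. Qed.

Lemma consv_lift k t (v : 'rV[R]_k) j : consv t v ord0 (lift ord0 j) = v ord0 j.
Proof. by rewrite mxE liftK. Qed.

Lemma inbox_consv k L t (v : 'rV[R]_k) :
  inbox L (consv t v) <-> `|t| <= L /\ inbox L v.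
Proof.
split=> [h|[tL vL] i].
  by split=> [|j]; [rewrite -(consv0 k t v)|rewrite -(consv_lift k t v)].
by case: (unliftP ord0 i) => [j|] ->; rewrite ?consv0 ?consv_lift.
Qed.

Lemma cvg_consv k (T : Type) (F : set_system T) {FF : Filter F}
    (g : T -> R) (h : T -> 'rV[R]_k) t (v : 'rV[R]_k) :
  g @ F --> t -> h @ F --> v -> (fun x => consv (g x) (h x)) @ F --> consv t v.
Proof.
move=> /cvg_ballP gt /cvg_ballP hv; apply/cvg_ballP => e e0.
apply: filterS2 (gt _ e0) (hv _ e0) => x gx [_ hx]; split=> // i j.
by rewrite !ord1; case: (unliftP ord0 j) => [l|] ->; rewrite ?consv0 ?consv_lift.
Qed.

Lemma slice_continuous k (f : 'rV[R]_k.+1 -> R) t :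
  continuous f -> continuous (fun v => f (consv t v)).
Proof.
move=> cf v; apply: (@cvg_comp _ _ _ (fun v => consv t v) f (nbhs v) (nbhs (consv t v))); last exact: cf.
  by apply: cvg_consv; [exact: cvg_cst|exact: cvg_id].
Qed.

(** Heine-Cantor in one variable: each point of the compact cube has a neighbourhood on which the
    bound holds for all [s] near [t], and finitely many of these cover the cube. *)
Lemma slice_uniform k L (f : 'rV[R]_k.+1 -> R) t (e : R) :
  continuous f -> 0 < e ->
  \forall s \near t, forall v, inbox L v ->
    `|f (consv t v) - f (consv s v)| <= e.
Proof.
move=> cf e0.
have cK : compact [set v : 'rV[R]_k | forall i, (`[- L, L]%classic : set R) (v ord0 i)].
  by apply: (@rV_compact R k (fun=> `[- L, L]%classic)) => _; exact: segment_compact.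
move/compact_near_coveringP : cK => /(_ R (nbhs t)
  (fun s v => `|f (consv t v) - f (consv s v)| <= e) _) H.
have {H}: \forall s \near t, [set v : 'rV[R]_k | forall i, (`[- L, L]%classic : set R) (v ord0 i)]
    `<=` (fun v => `|f (consv t v) - f (consv s v)| <= e).
  apply: H => v _.
  have cg : {for (v, t), continuous (fun p : 'rV[R]_k * R => f (consv p.2 p.1))}.
    apply: (@cvg_comp _ _ _ (fun p : 'rV[R]_k * R => consv p.2 p.1) f
      (nbhs (v, t)) (nbhs (consv t v))); last exact: cf.
    by apply: cvg_consv; [exact: cvg_snd|exact: cvg_fst].
  have cs : {for v, continuous (fun v => f (consv t v))} by exact: slice_continuous.
  have e2 : 0 < e / 2 by rewrite divr_gt0.
  move/cvgrPdist_le : cg => /(_ _ e2) [[A B] /= [nA nB] AB].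
  move/cvgrPdist_le : cs => /(_ _ e2) nC.
  (* Both values at [w] are compared with the value at [consv t v], each at a cost of [e / 2]. *)
  exists (A `&` [set w | `|f (consv t v) - f (consv t w)| <= e / 2], B) => /=.
    by split => //; exact: filterI.
  move=> [w s] /= [[Aw wC] Bs].
  have := AB (w, s) (conj Aw Bs) => /= h.
  rewrite (_ : _ - _ = (f (consv t v) - f (consv s w)) - (f (consv t v) - f (consv t w))); last by ring.
  by rewrite (le_trans (ler_normB _ _))// (splitr e) lerD.
apply: filterS => s H v vL; apply: H => i /=.
by rewrite in_itv /= -ler_norml; exact: vL.
Qed.

Lemma within_itv_continuous (a b : R) (f : R -> R) :
  continuous f -> {within `[a, b], continuous f}.
Proof. by move=> cf; exact: continuous_subspaceT. Qed.

Lemma itv_integrable L (f : R -> R) : continuous f ->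
  lebesgue_measure.-integrable `[- L, L] (EFin \o f).
Proof.
move=> cf; apply: continuous_compact_integrable; first exact: segment_compact.
exact: within_itv_continuous.
Qed.

Lemma Rintegral_itv_cst L c : 0 <= L ->
  \int[lebesgue_measure]_(t in `[- L, L]) c = c * (2 * L) :> R.
Proof.
move=> L0; rewrite Rintegral_cst//= lebesgue_measure_itv/= lte_fin.
case: ifPn => [_|]; first by rewrite -EFinD/=; ring.
rewrite -leNgt /= => h; have -> : L = 0 by lra.
by rewrite !mulr0.
Qed.

(* Bundled because linearity and monotonicity in dimension n give the continuity
   in t of the integral of the slices, hence their integrability, and so the same
   properties in dimension n + 1. *)
Definition boxint_linmono L n : Prop :=
  [/\ forall f g : 'rV[R]_n -> R, continuous f -> continuous g ->
        boxint L n (fun x => f x + g x) = boxint L n f + boxint L n g,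
      forall c (f : 'rV[R]_n -> R), continuous f ->
        boxint L n (fun x => c * f x) = c * boxint L n f,
      forall f g : 'rV[R]_n -> R, continuous f -> continuous g ->
        (forall x, inbox L x -> f x <= g x) -> boxint L n f <= boxint L n g &
      forall c, boxint L n (fun=> c) = c * (2 * L) ^+ n].

(** Takes [boxint_linmono] as a hypothesis because it serves inside the induction that proves
    [boxintP]. *)
Lemma boxint_linmono_dist L n (f g : 'rV[R]_n -> R) (e : R) :
  boxint_linmono L n -> continuous f -> continuous g ->
  (forall x, inbox L x -> `|f x - g x| <= e) ->
  `|boxint L n f - boxint L n g| <= e * (2 * L) ^+ n.
Proof.
move=> [bD bZ ble bc] cf cg fg.
have ce : continuous (fun _ : 'rV[R]_n => e) by exact: rcontinuous_cst.
have ble_add (a b : 'rV[R]_n -> R) : continuous a -> continuous b ->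
    (forall x, inbox L x -> a x <= b x + e) ->
    boxint L n a <= boxint L n b + e * (2 * L) ^+ n.
  move=> ca cb ab; rewrite -bc -bD//; apply: ble => //.
  exact: rcontinuousD.
rewrite ler_distlC lerBlDr; apply/andP; split; apply: ble_add => // x /fg.
  by rewrite ler_distlC => /andP[]; rewrite lerBlDr.
by rewrite ler_distlC => /andP[].
Qed.

Lemma boxint_linmono_continuous L n (f : 'rV[R]_n.+1 -> R) :
  0 <= L -> boxint_linmono L n -> continuous f ->
  continuous (fun t => boxint L n (fun v => f (consv t v))).
Proof.
move=> L0 H cf t; apply/cvgrPdist_le => e e0.
(* The added 1 keeps the divisor positive when the cube degenerates. *)
have M0 : 0 < (2 * L) ^+ n + 1 by rewrite ltr_wpDl// exprn_ge0// mulr_ge0.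
have := slice_uniform n L f t (e / ((2 * L) ^+ n + 1)) cf (divr_gt0 e0 M0).
apply: filterS => s fs.
have := boxint_linmono_dist L n _ _ _ H (slice_continuous _ _ t cf) (slice_continuous _ _ s cf) fs.
move/le_trans; apply.
by rewrite mulrAC ler_pdivrMr// ler_wpM2l ?(ltW e0)// lerDl.
Qed.

Lemma boxintP L n : 0 <= L -> boxint_linmono L n.
Proof.
move=> L0; elim: n => [|n IH].
  split=> //= [f g _ _ H|c]; last by rewrite mulr1.
  by apply: H => -[].
have C (f : 'rV[R]_n.+1 -> R) : continuous f -> lebesgue_measure.-integrable `[- L, L]
    (EFin \o (fun t => boxint L n (fun v => f (consv t v)))).
  by move=> cf; apply: itv_integrable; exact: boxint_linmono_continuous.
have S (f : 'rV[R]_n.+1 -> R) t := slice_continuous n f t.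
case: (IH) => bD bZ ble bc; split=> /= [f g cf cg|c f cf|f g cf cg fg|c].
- by rewrite -RintegralD//; [|exact: C..]; congr Rintegral; apply/funext => t; rewrite bD//; exact: S.
- by rewrite -RintegralZl//; [|exact: C]; congr Rintegral; apply/funext => t; rewrite bZ//; exact: S.
- apply: le_Rintegral => //; [exact: C..|] => t /= tL.
  apply: ble; [exact: S..|] => v vL; apply: fg; apply/inbox_consv; split=> //.
  by move: tL; rewrite in_itv /= -ler_norml.
- by under eq_Rintegral do rewrite bc; rewrite Rintegral_itv_cst// exprS; ring.
Qed.


(** A directional derivative sees only the restriction to a line, so it passes between spaces of
    different dimension whenever the restrictions agree. *)
Lemma is_derive_reparam (V W : normedModType R) (f : V -> R) (g : W -> R)
    x v y w (d : R) :
  (forall h : R, f (h *: v + x) = g (h *: w + y)) ->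
  is_derive x v f d -> is_derive y w g d.
Proof.
move=> fg [df <-].
have fg0 : f x = g y by have := fg 0; rewrite !scale0r !add0r.
have E : (fun h : R => h^-1 *: ((g \o shift y) (h *: w) - g y)) =
         (fun h : R => h^-1 *: ((f \o shift x) (h *: v) - f x)).
  by apply/funext => h /=; rewrite fg fg0.
by split; rewrite /derivable /derive E.
Qed.

(** The point [c] is located only within [|h|] of [t], which treats increments of both signs
    alike. *)
Lemma mean_value (f df : R -> R) (t h : R) :
  (forall s : R, is_derive s 1 f (df s)) ->
  exists2 c, `|t - c| <= `|h| & f (t + h) - f t = df c * h.
Proof.
move=> dfP.
have cf : continuous f.
  by move=> s; apply/differentiable_continuous/derivable1_diffP; case: (dfP s).
have [h0|h0] := leP 0 h.
  have [||c] := @MVT_segment _ f df t (t + h) _ (fun s _ => dfP s).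
  - by rewrite lerDl.
  - exact: within_itv_continuous.
  rewrite in_itv /= => /andP[tc ct] ->; exists c; last by rewrite addrC addKr.
  by rewrite distrC !ger0_norm ?subr_ge0// lerBlDl.
have [||c] := @MVT_segment _ f df (t + h) t _ (fun s _ => dfP s).
- by rewrite gerDl ltW.
- exact: within_itv_continuous.
rewrite in_itv /= => /andP[tc ct] E; exists c.
  by rewrite ger0_norm ?subr_ge0// ltr0_norm// lerBlDr -lerBlDl opprK.
by rewrite -opprB E opprD addNKr mulrN opprK.
Qed.

Lemma itv_FTC L (F f : R -> R) : 0 <= L -> continuous f ->
  (forall t : R, is_derive t 1 F (f t)) ->
  \int[lebesgue_measure]_(t in `[- L, L]) f t = F L - F (- L).
Proof.
move=> L0 cf dF.
have cF : continuous F.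
  by move=> s; apply/differentiable_continuous/derivable1_diffP; case: (dF s).
move: L0; rewrite le_eqVlt => /predU1P[<-|L0].
  by rewrite oppr0 subrr set_itv1 Rintegral_set1.
rewrite /Rintegral (@continuous_FTC2 _ f F)//=.
- by rewrite gtrN.
- exact: within_itv_continuous.
- split=> [x _||]; first by case: (dF x).
  + by apply: cvg_at_right_filter; exact: cF.
  + by apply: cvg_at_left_filter; exact: cF.
- by move=> x _; rewrite derive1E; exact: derive_val.
Qed.

(** By the mean value theorem, the difference quotient of each slice is a value of [g] on a nearby
    slice, uniformly close to the slice at [t] by [slice_uniform]. *)
Lemma boxint_is_derive L n (f g : 'rV[R]_n.+1 -> R) t :
  0 <= L -> continuous f -> continuous g ->
  (forall (s : R) v, is_derive s 1 (fun s => f (consv s v)) (g (consv s v))) ->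
  is_derive t 1 (fun s => boxint L n (fun v => f (consv s v)))
    (boxint L n (fun v => g (consv t v))).
Proof.
move=> L0 cf cg dfg.
set P := fun s => boxint L n (fun v => f (consv s v)).
set Q := boxint L n _.
have : (fun h : R => h^-1 *: ((P \o shift t) (h *: 1) - P t)) @ 0^' --> Q.
  apply/cvgrPdist_le => e e0.
  have M0 : 0 < (2 * L) ^+ n + 1 by rewrite ltr_wpDl// exprn_ge0// mulr_ge0.
  have := slice_uniform n L g t (e / ((2 * L) ^+ n + 1)) cg (divr_gt0 e0 M0).
  move=> [d /= d0 dP]; exists d => //= h.
  rewrite /ball_/= sub0r normrN => hd h0.
  rewrite [h%:A]mulr1 [h + t]addrC.
  have [bD bZ ble bc] := boxintP L n L0.
  have cfs s : continuous (fun v => f (consv s v)) by exact: slice_continuous.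
  rewrite (_ : h^-1 *: _ = boxint L n
      (fun v => h^-1 * (f (consv (t + h) v) + -1 * f (consv t v)))); last first.
    rewrite bZ; last by apply: rcontinuousD => //; apply: rcontinuousM => //; exact: rcontinuous_cst.
    rewrite bD//; last by apply: rcontinuousM => //; exact: rcontinuous_cst.
    by rewrite bZ// mulN1r.
  apply: le_trans (boxint_linmono_dist L n _ _ (e / ((2 * L) ^+ n + 1)) (boxintP L n L0) _ _ _) _.
  - exact: slice_continuous.
  - apply: rcontinuousM; first exact: rcontinuous_cst.
    by apply: rcontinuousD => //; apply: rcontinuousM => //; exact: rcontinuous_cst.
  - move=> v vL.
    have [c tc] := mean_value _ _ t h (fun s => dfg s v).
    rewrite mulN1r => ->; rewrite mulrCA mulVf// mulr1.
    by apply: dP => //=; exact: le_lt_trans tc hd.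
  - by rewrite mulrAC ler_pdivrMr// ler_wpM2l ?(ltW e0)// lerDl.
move=> H; split; first by apply/cvg_ex; exists Q.
exact: cvg_lim H.
Qed.

Lemma ebase_consv0 k t (v : 'rV[R]_k) (h : R) :
  h *: ebase R ord0 + consv t v = consv (h *: 1 + t) v.
Proof.
apply/rowP => i; rewrite !mxE; case: (unliftP ord0 i) => [j|] -> //=.
  by rewrite mulr0 add0r.
Qed.

Lemma ebase_consv_lift k t (v : 'rV[R]_k) j (h : R) :
  h *: ebase R (lift ord0 j) + consv t v = consv t (h *: ebase R j + v).
Proof.
apply/rowP => i; rewrite !mxE; case: (unliftP ord0 i) => [l|] -> //=.
  by rewrite mxE (inj_eq lift_inj) !mxE.
by rewrite mulr0 add0r.
Qed.

(* Differentiating in the first variable under the integral over the others takes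
   the place of Fubini's theorem: the last integration is then always along the
   differentiated coordinate. *)
Lemma boxint_divergence L n (F G : 'I_n -> 'rV[R]_n -> R) : 0 <= L ->
  (forall i, continuous (F i)) -> (forall i, continuous (G i)) ->
  (forall i x, is_derive x (ebase R i) (F i) (G i x)) ->
  (forall i x, inbox L x -> `|x ord0 i| = L -> F i x = 0) ->
  boxint L n (fun x => \sum_i G i x) = 0.
Proof.
move=> L0; elim: n F G => [|n IH] F G cF cG dF F0 /=; first by rewrite big_ord0.
have [bD bZ ble bc] := boxintP L n L0.
(* The remaining [n] terms form a divergence on the slice at [t]. The boundary condition passes to
   that slice only when [|t| <= L], hence the case distinction. *)
have tail t : boxint L n (fun v => \sum_(i < n) G (lift ord0 i) (consv t v)) =
    if `|t| <= L then 0 else boxint L n (fun v => \sum_(i < n) G (lift ord0 i) (consv t v)).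
  case: ifPn => // tL.
  apply: (IH (fun i v => F (lift ord0 i) (consv t v))) => i.
  - exact: slice_continuous.
  - exact: slice_continuous.
  - by move=> v; apply: is_derive_reparam (dF (lift ord0 i) (consv t v)) => h; rewrite ebase_consv_lift.
  - by move=> v vL viL; apply: F0; rewrite ?consv_lift//; exact/inbox_consv.
(* Zero is rewritten as the difference of the integrals over two opposite faces, the form that
   [itv_FTC] produces from the first term. *)
rewrite -[RHS](_ : boxint L n (fun v => F ord0 (consv L v)) -
  boxint L n (fun v => F ord0 (consv (- L) v)) = 0); last first.
  have z (s : R) : `|s| = L -> boxint L n (fun v => F ord0 (consv s v)) = 0.
    move=> sL; rewrite -[RHS](mul0r ((2 * L) ^+ n)) -bc.
    have cFs := slice_continuous n _ s (cF ord0).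
    have c0 : continuous (fun _ : 'rV[R]_n => 0 : R) by exact: rcontinuous_cst.
    by apply/le_anti/andP; split; apply: ble => // v vL;
      rewrite F0 ?consv0//; apply/inbox_consv; split => //; rewrite sL.
  by rewrite !z ?subr0// ?normrN ger0_norm.
have dF0 (t : R) : is_derive t 1 (fun s => boxint L n (fun v => F ord0 (consv s v)))
    (boxint L n (fun v => G ord0 (consv t v))).
  apply: boxint_is_derive => // s v.
  by apply: is_derive_reparam (dF ord0 (consv s v)) => h; rewrite ebase_consv0.
have cG0 := boxint_linmono_continuous L n _ L0 (boxintP L n L0) (cG ord0).
rewrite -(itv_FTC L _ _ L0 cG0 dF0).
apply: eq_Rintegral => t; rewrite inE /= in_itv /= -ler_norml => tL.
under [in LHS]eq_fun do rewrite big_ord_recl.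
rewrite bD; [|exact: slice_continuous|]; last first.
  by apply: rcontinuous_sum => i; exact: slice_continuous.
by rewrite tail tL addr0.
Qed.

End BoxIntegral.

(** * Iterated integrals over the whole space and their restriction to cubes *)

Section IteratedIntegral.
Context {R : realType}.

(* No measurability is required: the integral of a nonnegative function is a
   supremum over the simple functions below it. *)
Lemma le_ge0_integral (f g : R -> \bar R) :
  (forall x, (0 <= f x)%E) -> (forall x, (f x <= g x)%E) ->
  (\int[@lebesgue_measure R]_x f x <= \int[@lebesgue_measure R]_x g x)%E.
Proof.
move=> f0 fg.
rewrite !ge0_integralTE//; last by move=> x; exact: le_trans (f0 x) (fg x).
apply: le_ereal_sup => _ [h hf <-]; exists h => //= x.
exact: le_trans (hf x) (fg x).
Qed.

Lemma iterint_ge0 n (f : 'rV[R]_n -> \bar R) :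
  (forall x, (0 <= f x)%E) -> (0 <= iterint f)%E.
Proof.
elim: n f => [|n IH] f f0 //=; apply: integral_ge0 => t _.
by apply: IH => v.
Qed.

Lemma le_iterint n (f g : 'rV[R]_n -> \bar R) :
  (forall x, (0 <= f x)%E) -> (forall x, (f x <= g x)%E) ->
  (iterint f <= iterint g)%E.
Proof.
elim: n f g => [|n IH] f g f0 fg //=; apply: le_ge0_integral => t.
  exact: iterint_ge0.
exact: IH.
Qed.

Lemma iterint0 n : iterint (fun _ : 'rV[R]_n => 0%E) = 0%E.
Proof. by elim: n => //= n ->; exact: integral0. Qed.

(** Slices with [|t| > L] vanish identically; on the others the induction hypothesis gives a
    continuous function of [t], whose integral over the interval is finite. *)
Lemma iterint_box (L : R) n (f : 'rV[R]_n -> R) : 0 <= L -> continuous f ->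
  iterint (fun x => (if `[< inbox L x >] then f x else 0)%:E) = (boxint L n f)%:E.
Proof.
move=> L0; elim: n f => [|n IH] f cf /=.
  by case: asboolP => // -[] [].
transitivity (\int[@lebesgue_measure R]_t
    ((fun t => (boxint L n (fun v => f (consv t v)))%:E) \_ `[(- L)%R, L]) t)%E.
  apply: eq_integral => t _; rewrite patchE; case: ifPn.
    rewrite inE /= in_itv /= -ler_norml => tL.
    rewrite -IH; last exact: slice_continuous.
    congr iterint; apply/funext => v; congr EFin.
    rewrite -/(consv t v); congr (if _ then _ else _).
    by apply/asboolP/asboolP => [/inbox_consv[]//|vL]; exact/inbox_consv.
  rewrite notin_setE /= in_itv /= -ler_norml => tL.
  rewrite -[RHS](iterint0 n); congr iterint; apply/funext => v.
  by rewrite -/(consv t v); case: asboolP => // /inbox_consv[].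
rewrite -integral_mkcond /Rintegral fineK//.
apply: integrable_fin_num => //; apply: itv_integrable.
exact: boxint_linmono_continuous (boxintP L n L0) cf.
Qed.

Lemma boxint_prod L n (g : R -> R) : 0 <= L -> continuous g ->
  boxint L n (fun x => \prod_i g (x ord0 i)) =
  (\int[lebesgue_measure]_(t in `[- L, L]) g t) ^+ n.
Proof.
move=> L0 cg; elim: n => [|n IH] /=; first by rewrite big_ord0 expr0.
have [bD bZ ble bc] := boxintP L n L0.
have cp : continuous (fun v : 'rV[R]_n => \prod_i g (v ord0 i)).
  apply: rcontinuous_prod => i v.
  apply: (@continuous_comp _ _ _ (fun v : 'rV[R]_n => v ord0 i)).
    exact: coord_continuous.
  exact: cg.
rewrite exprSr -IH -[RHS]RintegralZl//; last exact: itv_integrable.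
apply: eq_Rintegral => t _.
under eq_fun => v.
  rewrite big_ord_recl consv0; under eq_bigr do rewrite consv_lift.
  over.
by rewrite bZ// mulrC.
Qed.

End IteratedIntegral.

(** * Partial derivatives *)

Section MixedDerivatives.
Context {R : realType} {V : normedModType R}.

Lemma is_derive_line (f df : V -> R) (v x : V) (s : R) :
  (forall y, is_derive y v f (df y)) ->
  is_derive s 1 (fun t => f (t *: v + x)) (df (s *: v + x)).
Proof.
move=> dfP; apply: is_derive_reparam (dfP (s *: v + x)) => h.
by rewrite [h%:A]mulr1 scalerDl addrA.
Qed.

(** The mean value theorem is applied twice: along [a] to the increment of [u] in the direction [b],
    then along [b] to [ua]. *)
Lemma second_difference (u ua uab : V -> R) (a b x : V) (h k : R) :
  (forall y, is_derive y a u (ua y)) -> (forall y, is_derive y b ua (uab y)) ->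
  exists c d, [/\ `|c| <= `|h|, `|d| <= `|k| &
    u (h *: a + (k *: b + x)) - u (h *: a + x) - (u (k *: b + x) - u x) =
    uab (d *: b + (c *: a + x)) * (h * k)].
Proof.
move=> dua duab.
pose phi t := u (t *: a + (k *: b + x)) - u (t *: a + x).
pose dphi t := ua (t *: a + (k *: b + x)) - ua (t *: a + x).
have dphiP (s : R) : is_derive s 1 phi (dphi s).
  by apply: is_deriveB; exact: is_derive_line.
have [c] := mean_value phi dphi 0 h dphiP.
rewrite sub0r normrN add0r => ch E1.
have [d] := mean_value _ _ 0 k (fun s => is_derive_line ua uab b (c *: a + x) s duab).
rewrite sub0r normrN add0r scale0r add0r => dk E2.
exists c, d; split => //.
move: E1; rewrite /phi scale0r !add0r => ->.
by rewrite /dphi addrCA E2 -mulrA [k * h]mulrC.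
Qed.

(** Schwarz's theorem: the second difference is symmetric in the two directions, so with equal steps
    it is [h * h] times a value of either mixed derivative near [x], and continuity at [x]
    concludes. *)
Lemma mixed_derive_comm (u ua ub uab uba : V -> R) (a b x : V) :
  (forall y, is_derive y a u (ua y)) -> (forall y, is_derive y b u (ub y)) ->
  (forall y, is_derive y b ua (uab y)) -> (forall y, is_derive y a ub (uba y)) ->
  {for x, continuous uab} -> {for x, continuous uba} -> uab x = uba x.
Proof.
move=> dua dub duab duba cab cba.
apply/eqP; rewrite -subr_eq0 -normr_le0; apply/ler_addgt0Pl => e e0; rewrite addr0.
have e2 : 0 < e / 2 by rewrite divr_gt0.
move/cvgrPdist_le : cab => /(_ _ e2) nab.
move/cvgrPdist_le : cba => /(_ _ e2) nba.
have [r /= r0 rP] := (nbhs_ballP _ _).1 (filterI nab nba).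
have M0 : 0 < `|a| + `|b| + 1 by rewrite ltr_wpDl// addr_ge0.
(* Small enough that all intermediate points stay in the ball of radius [r], also when both
   directions are zero. *)
pose h := r / 2 / (`|a| + `|b| + 1).
have h0 : 0 < h by rewrite divr_gt0// divr_gt0.
have inr c d : `|c| <= `|h| -> `|d| <= `|h| -> ball x r (d *: b + (c *: a + x)).
  move=> ch dh; rewrite -ball_normE /= addrA opprD addrCA subrr addr0 normrN.
  rewrite (le_lt_trans (ler_normD _ _))// !normrZ.
  apply: (@le_lt_trans _ _ (h * (`|a| + `|b|))).
    by rewrite mulrDr addrC lerD// ler_wpM2r// -(gtr0_norm h0).
  apply: (@le_lt_trans _ _ (r / 2)); last by lra.
  by rewrite /h mulrAC ler_pdivrMr// ler_wpM2l ?divr_ge0 ?(ltW r0)// lerDl.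
have [c [d [ch dh E]]] := second_difference u ua uab a b x h h dua duab.
have [c' [d' [ch' dh' E']]] := second_difference u ub uba b a x h h dub duba.
have EE : uab (d *: b + (c *: a + x)) = uba (d' *: a + (c' *: b + x)).
  apply: (@mulIf _ (h * h)); first by rewrite mulf_neq0// gt_eqF.
  by rewrite -E -E' [h *: a + (h *: b + x)]addrCA; ring.
have [/= h1 _] := rP _ (inr _ _ ch dh).
have [/= _ h2] := rP _ (inr _ _ dh' ch').
rewrite (_ : _ - _ = (uab x - uab (d *: b + (c *: a + x))) -
  (uba x - uba (d' *: a + (c' *: b + x)))); last by rewrite EE; ring.
by rewrite (le_trans (ler_normB _ _))// (splitr e) lerD// addrCA.
Qed.

End MixedDerivatives.

(** * Calculus of continuously differentiable functions with explicit gradients *)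

Section HasGrad.
Context {R : realType} {n : nat}.
Implicit Types (f g : 'rV[R]_n -> R) (F G : 'I_n -> 'rV[R]_n -> R).

(** The gradient is named, so that the rules below yield explicit partial derivatives whose
    continuity comes along, as [boxint_divergence] requires. *)
Definition has_grad f F : Prop :=
  continuous f /\ forall i, continuous (F i) /\
    forall x, is_derive x (ebase R i) f (F i x).

Lemma has_grad_eq f F G : has_grad f F -> (forall i x, F i x = G i x) ->
  has_grad f G.
Proof.
by move=> fF FG; rewrite (_ : G = F)//; apply/funext => i; apply/funext => x.
Qed.

Lemma has_gradE f F i x : has_grad f F -> pd i f x = F i x.
Proof. by move=> [_ /(_ i) [_ /(_ x) [_ <-]]]. Qed.

Lemma has_grad_pd f F : has_grad f F -> has_grad f (fun i => pd i f).
Proof. by move=> fF; apply: (has_grad_eq _ _ _ fF) => i x; rewrite (has_gradE _ _ _ _ fF). Qed.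

Lemma has_grad_cst (c : R) : has_grad (fun=> c) (fun _ _ => 0).
Proof.
split=> [|i]; first exact: rcontinuous_cst.
by split=> [|x]; [exact: rcontinuous_cst|exact: is_derive_cst].
Qed.

Lemma has_gradD f g F G : has_grad f F -> has_grad g G ->
  has_grad (fun x => f x + g x) (fun i x => F i x + G i x).
Proof.
move=> [cf dF] [cg dG]; split=> [|i]; first exact: rcontinuousD.
have [[cFi fF] [cGi gG]] := (dF i, dG i).
by split=> [|x]; [exact: rcontinuousD|exact: is_deriveD].
Qed.

Lemma has_gradM f g F G : has_grad f F -> has_grad g G ->
  has_grad (fun x => f x * g x) (fun i x => f x * G i x + g x * F i x).
Proof.
move=> [cf dF] [cg dG]; split=> [|i]; first exact: rcontinuousM.
have [[cFi fF] [cGi gG]] := (dF i, dG i).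
split=> [|x]; first by apply: rcontinuousD; exact: rcontinuousM.
exact: is_deriveM.
Qed.

Lemma has_gradZ (c : R) f F : has_grad f F ->
  has_grad (fun x => c * f x) (fun i x => c * F i x).
Proof.
move=> fF; apply: (has_grad_eq _ _ _ (has_gradM _ _ _ _ (has_grad_cst c) fF)).
by move=> i x /=; rewrite mulr0 addr0.
Qed.

Lemma has_grad_sum (I : Type) (s : seq I) (f : I -> 'rV[R]_n -> R)
    (F : I -> 'I_n -> 'rV[R]_n -> R) : (forall j, has_grad (f j) (F j)) ->
  has_grad (fun x => \sum_(j <- s) f j x) (fun i x => \sum_(j <- s) F j i x).
Proof.
move=> fF; elim: s => [|j s IH].
  rewrite (_ : (fun _ => _) = fun=> 0); last by apply/funext => x; rewrite big_nil.
  by apply: (has_grad_eq _ _ _ (has_grad_cst 0)) => i x; rewrite big_nil.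
rewrite (_ : (fun _ => _) = fun x => f j x + \sum_(j <- s) f j x); last first.
  by apply/funext => x; rewrite big_cons.
by apply: (has_grad_eq _ _ _ (has_gradD _ _ _ _ (fF j) IH)) => i x; rewrite big_cons.
Qed.

(** Restricting [f] to a line reduces this to the one-variable chain rule, so only a directional
    derivative of [f] is involved. *)
Lemma is_derive_comp1 (V : normedModType R) (h : R -> R) (f : V -> R) x v (a b : R) :
  is_derive (f x) 1 h a -> is_derive x v f b -> is_derive x v (h \o f) (a * b).
Proof.
move=> dh df.
have df0 : is_derive (0 : R) 1 (fun t : R => f (t *: v + x)) b.
  apply: is_derive_reparam df => t.
  by rewrite [t%:A]mulr1 addr0.
have dh0 : is_derive (f ((0 : R) *: v + x)) 1 h a by rewrite scale0r add0r.
have := @is_derive1_comp _ h (fun t : R => f (t *: v + x)) 0 a b dh0 df0.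
apply: is_derive_reparam => t.
by rewrite /= [t%:A]mulr1 addr0.
Qed.

(** The outer derivative is asked for only at values of [f], which admits the square root of a
    positive function. *)
Lemma has_grad_comp (h h' : R -> R) f F : has_grad f F ->
  (forall x, is_derive (f x) 1 h (h' (f x))) -> continuous (h' \o f) ->
  has_grad (h \o f) (fun i x => h' (f x) * F i x).
Proof.
move=> [cf dF] dh ch'; split=> [x|i].
  apply: continuous_comp; first exact: cf.
  by apply/differentiable_continuous/derivable1_diffP; case: (dh x).
have [cFi fF] := dF i.
by split=> [|x]; [exact: rcontinuousM|exact: is_derive_comp1].
Qed.

End HasGrad.

(** * Graphs and cutoff functions *)

Section Graph.
Context {R : realType} {n : nat}.
Implicit Types (u : 'rV[R]_n -> R) (x y : 'rV[R]_n).

Lemma iterpd_rcons (l : seq 'I_n) i u : iterpd (rcons l i) u = iterpd l (pd i u).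
Proof. by elim: l => //= j l ->. Qed.

Lemma smooth_pd u i : smooth u -> smooth (pd i u).
Proof. by move=> su l x; rewrite -iterpd_rcons; exact: su. Qed.

Lemma smooth_has_grad u : smooth u -> has_grad u (fun i => pd i u).
Proof.
move=> su; split=> [x|i]; first by case: (su [::] x).
split=> x; first by case: (su [:: i] x).
by case: (su [::] x) => _ /(_ i) /derivableP.
Qed.

Lemma pd_comm u i j x : smooth u -> pd i (pd j u) x = pd j (pd i u) x.
Proof.
move=> su.
have d v k y : smooth v -> is_derive y (ebase R k) v (pd k v y).
  by move=> /smooth_has_grad[_ /(_ k)[_ /(_ y)]].
have cc k l : continuous (pd k (pd l u)).
  by case: (smooth_has_grad _ (smooth_pd _ k (smooth_pd _ l su))).
have sp k : smooth (pd k u) by exact: smooth_pd.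
by apply: (mixed_derive_comm u (pd j u) (pd i u) _ _ (ebase R j) (ebase R i));
  [move=> y; exact: d..|exact: cc|exact: cc].
Qed.

Lemma dotp_grad u x : dotp (grad u x) (grad u x) = \sum_i pd i u x ^+ 2.
Proof. by apply: eq_bigr => i _; rewrite !mxE. Qed.

Lemma Wfac_gt0 u x : 0 < Wfac u x.
Proof.
rewrite sqrtr_gt0 ltr_wpDr// dotp_grad.
by apply: sumr_ge0 => i _; exact: sqr_ge0.
Qed.

Lemma sqr_Wfac u x : Wfac u x ^+ 2 = 1 + \sum_i pd i u x ^+ 2.
Proof.
rewrite sqr_sqrtr dotp_grad// addr_ge0//.
by apply: sumr_ge0 => i _; exact: sqr_ge0.
Qed.

Lemma Wfac_ge1 u x : 1 <= Wfac u x.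
Proof.
rewrite -(@ler_pXn2r _ 2)// ?nnegrE ?(ltW (Wfac_gt0 _ _))//.
rewrite expr1n sqr_Wfac lerDl; apply: sumr_ge0 => i _; exact: sqr_ge0.
Qed.

(** Minus the horizontal part of the unit normal; [mean_curv] is by definition minus its
    divergence. *)
Definition unitgrad u (i : 'I_n) : 'rV[R]_n -> R := fun y => pd i u y / Wfac u y.

Lemma has_grad_Wfac u : smooth u ->
  has_grad (Wfac u) (fun k x => \sum_i unitgrad u i x * pd k (pd i u) x).
Proof.
move=> su.
pose q x := 1 + \sum_i pd i u x * pd i u x.
have Wq : Wfac u = Num.sqrt \o q.
  by apply/funext => x; rewrite /Wfac dotp_grad.
have hq := has_gradD _ _ _ _ (has_grad_cst 1)
  (has_grad_sum _ (index_enum 'I_n) _ _ (fun i =>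
    has_gradM _ _ _ _ (smooth_has_grad _ (smooth_pd _ i su))
      (smooth_has_grad _ (smooth_pd _ i su)))).
have q0 x : 0 < q x by have := Wfac_gt0 u x; rewrite Wq sqrtr_gt0.
rewrite Wq; apply: has_grad_eq.
  apply: (has_grad_comp _ (fun s => (2 * Num.sqrt s)^-1) _ _ hq).
    by move=> x; apply: is_derive1_sqrt; exact: q0.
  apply: (rcontinuousV (fun x => 2 * Num.sqrt (q x))) => [|x]; last first.
    by rewrite mulf_neq0// gt_eqF// sqrtr_gt0.
  apply: rcontinuousM => [|x]; first exact: rcontinuous_cst.
  apply: (@continuous_comp _ _ _ q Num.sqrt); first by case: hq => + _; exact.
  exact: sqrt_continuous.
move=> k x /=; rewrite add0r mulr_sumr; apply: eq_bigr => i _.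
rewrite /unitgrad Wq /= -/(q x).
have : Num.sqrt (q x) != 0 by rewrite gt_eqF// sqrtr_gt0.
by move=> ?; field.
Qed.

Lemma has_gradV (f : 'rV[R]_n -> R) F : has_grad f F -> (forall x, f x != 0) ->
  has_grad (fun x => (f x)^-1) (fun i x => - (f x) ^- 2 * F i x).
Proof.
move=> [cf dF] f0; have cV := rcontinuousV _ cf f0.
split=> // i; have [cFi fF] := dF i; split=> [|x]; last first.
  have [dfx <-] := fF x.
  by split; [exact: derivableV|rewrite deriveV].
apply: rcontinuousM => //; apply: rcontinuousN.
rewrite (_ : (fun _ => _) = fun x => (f x)^-1 * (f x)^-1); first exact: rcontinuousM.
by apply/funext => x; rewrite expr2 invfM.
Qed.

Lemma has_grad_unitgrad u i : smooth u ->
  has_grad (unitgrad u i) (fun j => pd j (unitgrad u i)).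
Proof.
move=> su; apply: has_grad_pd.
apply: (has_gradM _ _ _ _ (smooth_has_grad _ (smooth_pd _ i su))).
apply: has_gradV (has_grad_Wfac _ su) _ => x.
by rewrite gt_eqF// Wfac_gt0.
Qed.

Lemma norm_unitgrad_le1 u i x : `|unitgrad u i x| <= 1.
Proof.
have W0 := Wfac_gt0 u x.
rewrite /unitgrad normrM normfV (gtr0_norm W0) ler_pdivrMr// mul1r.
rewrite -(@ler_pXn2r _ 2)// ?nnegrE ?(ltW W0)// real_normK ?num_real//.
rewrite sqr_Wfac (bigD1 i)//= addrCA lerDl addr_ge0//.
by apply: sumr_ge0 => j _; exact: sqr_ge0.
Qed.

(** From [|Du|^2 = W^2 - 1]. This pairing is what brings the area density [W] into the estimates. *)
Lemma unitgrad_dot_grad u x :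
  \sum_i pd i u x * unitgrad u i x = Wfac u x - (Wfac u x)^-1.
Proof.
have W0 : Wfac u x != 0 by rewrite gt_eqF// Wfac_gt0.
under eq_bigr do rewrite /unitgrad mulrA -expr2.
rewrite -mulr_suml (_ : \sum_i _ = Wfac u x ^+ 2 - 1); last by rewrite sqr_Wfac; ring.
by field.
Qed.

Lemma mean_curvE u x : mean_curv u x = - \sum_i pd i (unitgrad u i) x.
Proof. by []. Qed.

Lemma det_graph_metric u x : \det (graph_metric u x) = Wfac u x ^+ 2.
Proof.
rewrite sqr_Wfac -dotp_grad /graph_metric; move: (grad u x) => g.
(* Two block factorizations of the bordered matrix [1, -g; g^T, 1]. *)
have e1 : block_mx (1%:M : 'M[R]_1) (- g) (g^T) (1%:M : 'M[R]_n) =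
    block_mx 1%:M 0 (g^T) 1%:M *m block_mx 1%:M (- g) 0 (1%:M + g^T *m g).
  rewrite mulmx_block !(mul1mx, mul0mx, mulmx1, mulmx0, addr0, add0r).
  by rewrite mulmxN addrC addrK.
have e2 : block_mx (1%:M : 'M[R]_1) (- g) (g^T) (1%:M : 'M[R]_n) =
    block_mx 1%:M (- g) 0 1%:M *m block_mx (1%:M + g *m g^T) 0 (g^T) 1%:M.
  by rewrite mulmx_block !(mul1mx, mul0mx, mulmx1, mulmx0, addr0, add0r) mulNmx addrK.
have := congr1 determinant e1; rewrite e2 !det_mulmx.
rewrite !(det_lblock, det_ublock) !det1 !mul1r !mulr1 => <-.
rewrite det_mx11 !mxE eqxx; congr (_ + _).
by apply: eq_bigr => i _; rewrite !mxE.
Qed.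

Lemma dotp_row_mx (x y : 'rV[R]_n) (s t : R) :
  dotp (row_mx x s%:M) (row_mx y t%:M) = dotp x y + s * t.
Proof.
rewrite /dotp big_split_ord/= big_ord1 !row_mxEr !mxE eqxx !mulr1n; congr (_ + _).
by apply: eq_bigr => i _; rewrite !row_mxEl.
Qed.

End Graph.

(** * The cutoff of a cube and the ramp in the height *)

Section Cutoff.
Context {R : realType} {n : nat}.
Implicit Types (u : 'rV[R]_n -> R) (x : 'rV[R]_n) (L P s t : R).

(** A parabola is differentiable everywhere and vanishes at both ends of the interval, as the
    divergence theorem needs; its bounds are used only inside the cube. *)
Definition hat L t : R := 1 - (t / L) ^+ 2.

Definition cutoff L x : R := \prod_i hat L (x ord0 i).

Definition dcutoff L (i : 'I_n) x : R :=
  - 2 / L ^+ 2 * x ord0 i * \prod_(j | j != i) hat L (x ord0 j).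

Lemma has_grad_coord (j : 'I_n) :
  has_grad (fun x : 'rV[R]_n => x ord0 j) (fun i _ => (i == j)%:R).
Proof.
split=> [|i]; first exact: coord_continuous.
split=> [|x]; first exact: rcontinuous_cst.
have H : is_derive (0 : R) 1 ((i == j)%:R *: id + cst (x ord0 j) : R -> R) (i == j)%:R.
  by apply: is_derive_eq; rewrite addr0 [_%:A]mulr1.
apply: is_derive_reparam H => h.
rewrite [h%:A]mulr1 addr0 !mxE/= [j == i]eq_sym.
by transitivity ((i == j)%:R * h + x ord0 j) => //; rewrite mulrC.
Qed.

Lemma continuous_hat L : continuous (hat L).
Proof.
apply: rcontinuousD; first exact: rcontinuous_cst.
have c1 : continuous (fun t => t / L).
  by apply: rcontinuousM; [move=> t; exact: cvg_id|exact: rcontinuous_cst].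
by apply: rcontinuousN; exact: (rcontinuousM (fun t => t / L)).
Qed.

Lemma has_grad_cutoff L : has_grad (cutoff L) (dcutoff L).
Proof.
have cb (j : 'I_n) : continuous (fun x : 'rV[R]_n => hat L (x ord0 j)).
  move=> x; apply: (@continuous_comp _ _ _ (fun v : 'rV[R]_n => v ord0 j)).
    exact: coord_continuous.
  exact: continuous_hat.
split=> [|i]; first exact: rcontinuous_prod.
split=> [|x].
  apply: rcontinuousM; last exact: rcontinuous_prod.
  by apply: rcontinuousM; [exact: rcontinuous_cst|exact: coord_continuous].
have -> : cutoff L = (fun x => hat L (x ord0 i)) *
    (fun x => \prod_(j | j != i) hat L (x ord0 j)).
  by apply/funext => y; rewrite /cutoff (bigD1 i).
have d1 : is_derive x (ebase R i) (fun x => hat L (x ord0 i)) (- 2 / L ^+ 2 * x ord0 i).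
  have := has_gradD _ _ _ _ (has_grad_cst 1)
    (has_gradZ (- L^-1 ^+ 2) _ _ (has_gradM _ _ _ _ (has_grad_coord i) (has_grad_coord i))).
  move=> [_ /(_ i) [_ /(_ x)]]; rewrite eqxx.
  rewrite (_ : (fun _ => _) = (fun x => hat L (x ord0 i))).
    by move=> h; apply: is_derive_eq h _; rewrite exprVn mulr1n; ring.
  by apply/funext => y; rewrite /hat; ring.
(* The other factors are constant along the direction [i]. *)
have d2 : is_derive x (ebase R i) (fun x => \prod_(j | j != i) hat L (x ord0 j)) 0.
  have := is_derive_cst (\prod_(j | j != i) hat L (x ord0 j)) (0 : R) 1.
  apply: is_derive_reparam => h /=; apply: eq_bigr => j ji.
  by rewrite !mxE (negbTE ji) andbF mulr0 add0r.
by apply: is_derive_eq; rewrite /dcutoff scaler0 add0r [_ *: _]mulrC.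
Qed.

Lemma hat_itv L t : 0 < L -> `|t| <= L -> 0 <= hat L t <= 1.
Proof.
move=> L0 tL; rewrite subr_ge0 gerBl sqr_ge0 andbT.
by rewrite -real_normK ?num_real// exprn_ile1// normrM normfV (gtr0_norm L0) ler_pdivrMr// mul1r.
Qed.

Lemma cutoff_itv L x : 0 < L -> inbox L x -> 0 <= cutoff L x <= 1.
Proof.
move=> L0 xL; apply/andP; split.
  by apply: prodr_ge0 => i _; have /andP[] := hat_itv L _ L0 (xL i).
by apply: prodr_ile1 => i _; exact: hat_itv.
Qed.

Lemma norm_dcutoff_le L i x : 0 < L -> inbox L x -> `|dcutoff L i x| <= 2 / L.
Proof.
move=> L0 xL.
have p0 : 0 <= \prod_(j | j != i) hat L (x ord0 j).
  by apply: prodr_ge0 => j _; have /andP[] := hat_itv L _ L0 (xL j).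
have p1 : \prod_(j | j != i) hat L (x ord0 j) <= 1.
  by apply: prodr_ile1 => j _; exact: hat_itv.
rewrite /dcutoff !normrM (ger0_norm p0) normrN normfV normr_nat (ger0_norm (exprn_ge0 2 (ltW L0))).
apply: (@le_trans _ _ (2 / L ^+ 2 * L)); last by rewrite expr2 invfM mulrA mulfVK ?gt_eqF.
have c0 : 0 <= 2 / L ^+ 2 by rewrite divr_ge0// exprn_ge0// ltW.
rewrite -[leRHS]mulr1; apply: ler_pM => //; first by rewrite mulr_ge0.
exact: ler_wpM2l.
Qed.

Lemma cutoff_boundary L x i : 0 < L -> `|x ord0 i| = L -> cutoff L x = 0.
Proof.
move=> L0 xi; rewrite /cutoff (bigD1 i)//= /hat -real_normK ?num_real//.
by rewrite normrM normfV xi (gtr0_norm L0) divff ?gt_eqF// expr1n subrr mul0r.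
Qed.

(** A smooth, bounded substitute for [s + P]: its slope [2 / (1 + (s / P)^2)] is positive everywhere
    and falls to 1 exactly at [|s| = P]. *)
Definition ramp P s : R := 2 * P * (pi / 2 + atan (s / P)).

Definition dramp P s : R := 2 * (1 + (s / P) ^+ 2)^-1.

Lemma has_grad_ramp u P : 0 < P -> smooth u ->
  has_grad (fun x => ramp P (u x)) (fun i x => dramp P (u x) * pd i u x).
Proof.
move=> P0 su.
have ha : has_grad (atan \o (fun x => P^-1 * u x))
    (fun i x => (1 + (P^-1 * u x) ^+ 2)^-1 * (P^-1 * pd i u x)).
  apply: (has_grad_comp atan (fun s => (1 + s ^+ 2)^-1)).
    by apply: has_gradZ; exact: smooth_has_grad.
  have cu : continuous u by case: (smooth_has_grad _ su).
  apply: (rcontinuousV (fun x => 1 + (P^-1 * u x) ^+ 2)) => [|x]; last first.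
    by rewrite gt_eqF// ltr_wpDr// sqr_ge0.
  apply: rcontinuousD; first exact: rcontinuous_cst.
  by apply: (rcontinuousM (fun x => P^-1 * u x)); apply: rcontinuousM => //; exact: rcontinuous_cst.
have := has_gradZ (2 * P) _ _ (has_gradD _ _ _ _ (has_grad_cst (pi / 2)) ha).
rewrite (_ : (fun _ => _) = (fun x => ramp P (u x))); last first.
  by apply/funext => x; rewrite /ramp/= [P^-1 * _]mulrC.
move/has_grad_eq; apply=> i x; rewrite /dramp add0r [P^-1 * u x]mulrC.
by rewrite mulrCA -[2 * P * _]mulrA mulVKf ?gt_eqF//; ring.
Qed.

Lemma ramp_itv P s : 0 < P -> 0 <= ramp P s <= 2 * P * pi.
Proof.
move=> P0; have := atan_gtNpi2 (s / P); have := atan_ltpi2 (s / P).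
have P2 : 0 <= 2 * P by rewrite mulr_ge0// ltW.
by move=> h1 h2; rewrite mulr_ge0 ?ler_wpM2l//; lra.
Qed.

Lemma dramp_ge0 P s : 0 <= dramp P s.
Proof. by rewrite mulr_ge0// invr_ge0 addr_ge0// sqr_ge0. Qed.

Lemma dramp_ge1 P s : 0 < P -> `|s| <= P -> 1 <= dramp P s.
Proof.
move=> P0 sP; rewrite /dramp ler_pdivlMr ?ltr_wpDr ?sqr_ge0// mul1r.
rewrite -lerBrDl; apply: (@le_trans _ _ 1); last by lra.
by rewrite -real_normK ?num_real// exprn_ile1// normrM normfV (gtr0_norm P0) ler_pdivrMr// mul1r.
Qed.

Lemma itv_int_sqr_hat L : 0 < L ->
  \int[lebesgue_measure]_(t in `[- L, L]) (hat L t ^+ 2) = 16 / 15 * L.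
Proof.
(* The odd antiderivative of [(1 - t^2 / L^2)^2]; its increment is [2 L (1 - 2/3 + 1/5)]. *)
move=> L0; pose p : {poly R} := 'X - (2 / 3 / L ^+ 2) *: 'X^3 + (L ^- 4 / 5) *: 'X^5.
have Lneq0 : L != 0 by rewrite gt_eqF.
have pE (t : R) : hat L t ^+ 2 = (p^`()).[t].
  by rewrite /p !(poly.derivE, hornerE)/= /hat; field.
under eq_Rintegral do rewrite pE.
rewrite (itv_FTC L (horner p) (horner (p^`())))//; [|exact: ltW|exact: continuous_horner].
by rewrite /p !hornerE/=; field.
Qed.

End Cutoff.

(** * Volume growth *)

Section Estimates.
Context {R : realType} {n : nat}.
Implicit Types (u : 'rV[R]_n -> R) (x : 'rV[R]_n).

Lemma boxint_div_has_grad (L : R) (F : 'I_n -> 'rV[R]_n -> R)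
    (G : 'I_n -> 'I_n -> 'rV[R]_n -> R) : 0 <= L ->
  (forall i, has_grad (F i) (G i)) ->
  (forall i x, `|x ord0 i| = L -> F i x = 0) ->
  continuous (fun x => \sum_i G i i x) /\ boxint L n (fun x => \sum_i G i i x) = 0.
Proof.
move=> L0 FG F0; split.
  by apply: rcontinuous_sum => i; case: (FG i) => _ /(_ i) [].
apply: (boxint_divergence L n F (fun i => G i i)) => // [i|i|i x|i x _].
- by case: (FG i).
- by case: (FG i) => _ /(_ i) [].
- by case: (FG i) => _ /(_ i) [].
- exact: F0.
Qed.

Lemma norm_sum_le (c : R) (a : 'I_n -> R) : (forall i, `|a i| <= c) ->
  `|\sum_i a i| <= c *+ n.
Proof.
move=> ac; rewrite (le_trans (ler_norm_sum _ _ _))//.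
by rewrite (le_trans (ler_sum _ (fun i _ => ac i)))// sumr_const card_ord.
Qed.

(** [D] is the divergence of [eta T(u) V], with no flux through the faces. The nonnegativity clause
    serves the points of the cube whose graph point lies outside the ball. *)
Lemma area_density_bound u (L P : R) : smooth u -> (forall x, mean_curv u x <= 0) ->
  0 < L -> 0 < P ->
  exists D : 'rV[R]_n -> R, [/\ continuous D, boxint L n D = 0,
    forall x, inbox L x -> 0 <= 1 + 2 * P * pi * (2 / L *+ n) + D x &
    forall x, inbox L x -> `|u x| <= P ->
      cutoff L x * Wfac u x <= 1 + 2 * P * pi * (2 / L *+ n) + D x].
Proof.
move=> su H L0 P0.
have hF i := has_gradM _ _ _ _
  (has_gradM _ _ _ _ (has_grad_cutoff L) (has_grad_ramp u P P0 su)) (has_grad_unitgrad u i su).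
have [] := boxint_div_has_grad L _ _ (ltW L0) hF.
  by move=> i x xi; rewrite (cutoff_boundary L x i)// !mul0r.
set D := (fun x => \sum_i _) => cD D0.
suff main x : inbox L x -> 0 <= 1 + 2 * P * pi * (2 / L *+ n) + D x /\
    (`|u x| <= P -> cutoff L x * Wfac u x <= 1 + 2 * P * pi * (2 / L *+ n) + D x).
  by exists D; split=> // x /main [].
move=> xL.
have /andP[c0 c1] := cutoff_itv L x L0 xL.
have /andP[t0 t1] := ramp_itv P (u x) P0.
have dt0 := dramp_ge0 P (u x).
have W0 := Wfac_gt0 u x.
have Wi0 : 0 < (Wfac u x)^-1 by rewrite invr_gt0.
have Wi1 : (Wfac u x)^-1 <= 1 by rewrite invf_le1// Wfac_ge1.
have A0 : 0 <= Wfac u x - (Wfac u x)^-1.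
  by rewrite subr_ge0 (le_trans Wi1)// Wfac_ge1.
(* Product rule: a curvature term, nonnegative since [H <= 0]; a term in [<V, Du>]; and a cutoff
   error. *)
have DE : D x = cutoff L x * ramp P (u x) * (\sum_i pd i (unitgrad u i) x) +
    cutoff L x * dramp P (u x) * (Wfac u x - (Wfac u x)^-1) +
    ramp P (u x) * (\sum_i unitgrad u i x * dcutoff L i x).
  rewrite -unitgrad_dot_grad /D !mulr_sumr -!big_split/=.
  by apply: eq_bigr => i _; ring.
have b0 : - (2 * P * pi * (2 / L *+ n)) <=
    ramp P (u x) * (\sum_i unitgrad u i x * dcutoff L i x).
  rewrite lerNl -mulrN; apply: (@le_trans _ _ (ramp P (u x) * (2 / L *+ n))).
    apply: ler_wpM2l => //; apply: (le_trans (ler_norm _)); rewrite normrN.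
    apply: norm_sum_le => i; rewrite normrM -[leRHS]mul1r.
    by apply: ler_pM => //; [exact: norm_unitgrad_le1|exact: norm_dcutoff_le].
  by apply: ler_wpM2r => //; rewrite mulrn_wge0// divr_ge0// ltW.
have h0 : 0 <= cutoff L x * ramp P (u x) * (\sum_i pd i (unitgrad u i) x).
  apply: mulr_ge0; first exact: mulr_ge0.
  by have := H x; rewrite mean_curvE oppr_le0.
rewrite DE; split=> [|uP].
  have : 0 <= cutoff L x * dramp P (u x) * (Wfac u x - (Wfac u x)^-1).
    by apply: mulr_ge0 => //; exact: mulr_ge0.
  by lra.
have dt1 := dramp_ge1 P (u x) P0 uP.
have : cutoff L x * (Wfac u x - (Wfac u x)^-1) <=
    cutoff L x * dramp P (u x) * (Wfac u x - (Wfac u x)^-1).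
  by apply: ler_wpM2r => //; rewrite -[leLHS]mulr1; exact: ler_wpM2l.
(* This is the part [eta / W] that the summand 1 of the bound pays for. *)
have : cutoff L x * (Wfac u x)^-1 <= 1.
  by rewrite -[leRHS]mul1r; apply: ler_pM => //; exact: ltW.
by lra.
Qed.

Lemma graph_ball_vol_le u : smooth u -> (forall x, mean_curv u x <= 0) ->
  exists C : R, 0 < C /\
    forall r : R, 0 < r -> (graph_ball_vol u r <= (C * r ^+ n)%:E)%E.
Proof.
move=> su H.
have K0 : 0 < 1 + 2 * pi *+ n :> R by rewrite ltr_pwDl// mulrn_wge0// mulr_ge0// pi_ge0.
(* The cutoff is at least [(3/4)^n] where all [|x_i| <= r], the error term is [2 pi n] for [L = 2r]
   and [P = r], and the cube has side [4r]. *)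
exists ((4 / 3) ^+ n * (1 + 2 * pi *+ n) * 4 ^+ n); split.
  by rewrite !mulr_gt0 ?exprn_gt0// divr_gt0.
move=> r r0.
have L0 : 0 < 2 * r by rewrite mulr_gt0.
have [D [cD D0 Dge0 DW]] := area_density_bound u (2 * r) r su H L0 r0.
have KE : 1 + 2 * r * pi * (2 / (2 * r) *+ n) = 1 + 2 * pi *+ n :> R.
  by rewrite mulrnAr; congr (_ + _ *+ n); field; rewrite gt_eqF.
rewrite KE in Dge0 DW.
pose f x := (4 / 3) ^+ n * (1 + 2 * pi *+ n + D x).
have c43 : 0 <= (4 / 3 : R) ^+ n by rewrite exprn_ge0// divr_ge0.
have cK : continuous (fun x : 'rV[R]_n => 1 + 2 * pi *+ n + D x).
  by apply: rcontinuousD => //; exact: rcontinuous_cst.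
have cf : continuous f by apply: rcontinuousM => //; exact: rcontinuous_cst.
(* Since [D] integrates to zero, the right-hand side is exactly the integral of [f], and a pointwise
   comparison suffices. *)
rewrite (_ : _ * r ^+ n = boxint (2 * r) n f); last first.
  have [bD bZ ble bc] := boxintP (2 * r) n (ltW L0).
  rewrite bZ// bD//; last exact: rcontinuous_cst.
  rewrite D0 bc addr0 (_ : 2 * (2 * r) = 4 * r); last by ring.
  by rewrite [(4 * r) ^+ n]exprMn; ring.
rewrite -iterint_box ?(ltW L0)//; apply: le_iterint => x.
  by rewrite lee_fin; case: ifP => // _; exact: sqrtr_ge0.
rewrite lee_fin det_graph_metric sqrtr_sqr gtr0_norm ?Wfac_gt0//.
rewrite dotp_row_mx; case: ifPn => [xr|_]; last first.
  by case: asboolP => // xL; rewrite mulr_ge0// Dge0.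
have sq0 : forall i, 0 <= x ord0 i * x ord0 i by move=> i; rewrite -expr2 sqr_ge0.
have dot0 : 0 <= dotp x x by apply: sumr_ge0.
have ur : `|u x| <= r.
  rewrite -(@ler_pXn2r _ 2)// ?nnegrE ?(ltW r0)// real_normK ?num_real// expr2.
  by apply: ltW; apply: le_lt_trans xr; rewrite lerDr.
have xir i : `|x ord0 i| <= r.
  rewrite -(@ler_pXn2r _ 2)// ?nnegrE ?(ltW r0)// real_normK ?num_real// expr2.
  apply: ltW; apply: le_lt_trans xr; rewrite {1}/dotp (bigD1 i)//= -addrA lerDl.
  by rewrite addr_ge0 -?expr2 ?sqr_ge0// sumr_ge0.
have xL : inbox (2 * r) x by move=> i; rewrite (le_trans (xir i))//; lra.
case: asboolP => // _.
apply: le_trans (ler_wpM2l c43 (DW x xL ur)).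
rewrite mulrA -[leLHS]mul1r ler_wpM2r ?(ltW (Wfac_gt0 _ _))//.
(* The powers of [4/3] are distributed over the coordinates; each factor [4/3 * hat] is then at
   least 1. *)
rewrite /cutoff -[X in _ ^+ X]card_ord -prodr_const -big_split/=.
elim/big_ind: _ => // [a b a1 b1|i _]; first by rewrite mulr_ege1.
have : (x ord0 i / (2 * r)) ^+ 2 <= (1 / 2) ^+ 2.
  rewrite -real_normK ?num_real// ler_pXn2r ?nnegrE ?divr_ge0//.
  rewrite normrM normfV (gtr0_norm L0) ler_pdivrMr// (le_trans (xir i))//; lra.
rewrite /hat expr2 => h.
by lra.
Qed.

End Estimates.

(** * Translating solitons *)

Section Soliton.
Context {R : realType} {n : nat}.
Variables (u : 'rV[R]_n -> R) (b : 'rV[R]_n) (alpha : R).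
Hypothesis su : smooth u.
Hypothesis ab1 : dotp b b + alpha ^+ 2 = 1.

Implicit Types x : 'rV[R]_n.

(** For [a = (b, alpha)], [p] is [<b, Du>] and [S] is the height [<X, a>] in the graph chart, so
    [H = <nu, a>] reads [H = (alpha - p) / W]. *)
Let p x := \sum_k b ord0 k * pd k u x.
Let S x := \sum_k b ord0 k * x ord0 k + alpha * u x.

Hypothesis soliton : forall x, mean_curv u x = (alpha - p x) / Wfac u x.

Lemma norm_coeff_le1 i : `|b ord0 i| <= 1.
Proof.
rewrite -(@ler_pXn2r _ 2)// ?nnegrE// real_normK ?num_real// expr1n -ab1.
rewrite /dotp (bigD1 i)//= -expr2 -addrA lerDl addr_ge0 ?sqr_ge0//.
by apply: sumr_ge0 => j _; rewrite -expr2 sqr_ge0.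
Qed.

Lemma norm_alpha_le1 : `|alpha| <= 1.
Proof.
rewrite -(@ler_pXn2r _ 2)// ?nnegrE// real_normK ?num_real// expr1n -ab1 lerDr.
by apply: sumr_ge0 => j _; rewrite -expr2 sqr_ge0.
Qed.

(* Z^i = sqrt(det g) g^(ij) d_j S for the height S and the graph metric g, so
   div Z is sqrt(det g) times the Laplacian of S on the graph. *)
Let Z i x := b ord0 i * Wfac u x + (-1 * (unitgrad u i x * p x) + alpha * unitgrad u i x).

Let dZ i (j : 'I_n) x :=
  b ord0 i * (\sum_k unitgrad u k x * pd j (pd k u) x) +
  (-1 * (unitgrad u i x * (\sum_k b ord0 k * pd j (pd k u) x) +
         p x * pd j (unitgrad u i) x) + alpha * pd j (unitgrad u i) x).

Lemma has_grad_Z i : has_grad (Z i) (dZ i).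
Proof.
have hp : has_grad p (fun j x => \sum_k b ord0 k * pd j (pd k u) x).
  by apply: has_grad_sum => k; apply: has_gradZ; exact: smooth_has_grad (smooth_pd _ k su).
have hV := has_grad_unitgrad u i su.
apply: has_gradD; first by apply: has_gradZ; exact: has_grad_Wfac.
apply: has_gradD; last exact: has_gradZ.
by apply: has_gradZ; exact: has_gradM.
Qed.

(** This is [W] times [Delta S = - H^2]. The derivatives of [W] and [p] cancel by symmetry of the
    Hessian, leaving [(alpha - p) div V], where [div V = - H]. *)
Lemma div_Z x : \sum_i dZ i i x = - ((alpha - p x) ^+ 2 / Wfac u x).
Proof.
have E : \sum_i b ord0 i * (\sum_k unitgrad u k x * pd i (pd k u) x) =
    \sum_i unitgrad u i x * (\sum_k b ord0 k * pd i (pd k u) x).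
  under eq_bigr do rewrite mulr_sumr.
  rewrite exchange_big /=; apply: eq_bigr => k _; rewrite mulr_sumr.
  by apply: eq_bigr => i _; rewrite (pd_comm u i k x su); ring.
have dv : \sum_i pd i (unitgrad u i) x = - ((alpha - p x) / Wfac u x).
  by rewrite -soliton mean_curvE opprK.
rewrite big_split/= E -big_split/=.
transitivity ((alpha - p x) * \sum_i pd i (unitgrad u i) x).
  by rewrite mulr_sumr; apply: eq_bigr => i _; ring.
by rewrite dv; ring.
Qed.

(** This is [W |grad S|^2 = W (1 - H^2)], by [|a| = 1]. *)
Lemma Z_dot_grad x : \sum_i Z i x * (b ord0 i + alpha * pd i u x) =
  Wfac u x - (alpha - p x) ^+ 2 / Wfac u x.
Proof.
have W0 : Wfac u x != 0 by rewrite gt_eqF// Wfac_gt0.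
have Vb : \sum_i unitgrad u i x * b ord0 i = p x / Wfac u x.
  by rewrite mulr_suml; apply: eq_bigr => i _; rewrite /unitgrad; ring.
have Vg := unitgrad_dot_grad u x.
transitivity (Wfac u x * dotp b b + alpha * Wfac u x * p x +
   (alpha - p x) * (\sum_i unitgrad u i x * b ord0 i) +
   (alpha - p x) * alpha * (\sum_i pd i u x * unitgrad u i x)).
  rewrite /dotp {1}/p !mulr_sumr -!big_split/=; apply: eq_bigr => i _.
  by rewrite /Z; ring.
rewrite Vb Vg (_ : dotp b b = 1 - alpha ^+ 2); last by rewrite -ab1; ring.
by field.
Qed.

(** A crude bound: [n W] for the term with [p], and [W] for each of the other two. *)
Lemma norm_Z_le i x : `|Z i x| <= (n%:R + 2) * Wfac u x.
Proof.
have W0 := Wfac_gt0 u x.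
have W1 := Wfac_ge1 u x.
have V1 := norm_unitgrad_le1 u i x.
have h1 : `|b ord0 i * Wfac u x| <= Wfac u x.
  by rewrite normrM (gtr0_norm W0) -[leRHS]mul1r ler_wpM2r ?norm_coeff_le1// ltW.
have hp : `|p x| <= n%:R * Wfac u x.
  rewrite mulr_natl; apply: norm_sum_le => k.
  have -> : pd k u x = unitgrad u k x * Wfac u x by rewrite /unitgrad mulfVK ?gt_eqF.
  rewrite mulrA normrM (gtr0_norm W0) -[leRHS]mul1r; apply: ler_wpM2r; first exact: ltW.
  rewrite normrM -[leRHS]mul1r; apply: ler_pM => //; first exact: norm_coeff_le1.
  exact: norm_unitgrad_le1.
have h2 : `|unitgrad u i x * p x| <= n%:R * Wfac u x.
  by rewrite normrM -[leRHS]mul1r; apply: ler_pM.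
have h3 : `|alpha * unitgrad u i x| <= Wfac u x.
  by rewrite normrM (le_trans _ W1)// mulr_ile1 ?norm_alpha_le1.
rewrite /Z mulN1r; apply: (le_trans (ler_normD _ _)).
have := ler_normD (- (unitgrad u i x * p x)) (alpha * unitgrad u i x).
by rewrite normrN; lra.
Qed.

Let f x := expR (-1 * S x).

Lemma has_grad_f : has_grad f (fun i x => f x * (-1 * (b ord0 i + alpha * pd i u x))).
Proof.
have hS : has_grad S (fun i x => b ord0 i + alpha * pd i u x).
  have := has_gradD _ _ _ _ (has_grad_sum _ (index_enum 'I_n) _ _ (fun k => has_gradZ (b ord0 k) _ _ (has_grad_coord k)))
    (has_gradZ alpha _ _ (smooth_has_grad u su)).
  move/has_grad_eq; apply=> i x; congr (_ + _).
  rewrite (bigD1 i)//= eqxx mulr1 big1 ?addr0// => j ji.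
  by rewrite eq_sym (negbTE ji) mulr0.
apply: (has_grad_comp expR expR _ _ (has_gradZ (-1) _ _ hS)).
move=> x; apply: (@continuous_comp _ _ _ (fun x => -1 * S x)); last exact: continuous_expR.
by case: (has_gradZ (-1) _ _ hS) => cS _; exact: cS.
Qed.

(** [D] is the divergence of [- eta^2 f Z]. The terms in [H^2] from [div_Z] and [Z_dot_grad] cancel,
    and the cross term keeps one factor [eta] beside [W], just what [area_density_bound]
    controls. *)
Lemma soliton_div (L : R) : 0 < L ->
  exists D : 'rV[R]_n -> R, [/\ continuous D, boxint L n D = 0 &
    forall x, inbox L x ->
      cutoff L x ^+ 2 * f x * Wfac u x -
      (4 * n%:R * (n%:R + 2) / L) * (f x * (cutoff L x * Wfac u x)) <= D x].
Proof.
move=> L0.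
pose eta := @cutoff R n L.
have hQ := has_gradM _ _ _ _ (has_gradM _ _ _ _ (has_grad_cutoff L) (has_grad_cutoff L)) has_grad_f.
have hF i := has_gradZ (-1) _ _ (has_gradM _ _ _ _ hQ (has_grad_Z i)).
have [] := boxint_div_has_grad L _ _ (ltW L0) hF.
  by move=> i x xi; rewrite (cutoff_boundary L x i)// !mul0r mulr0.
set D := (fun x => \sum_i _) => cD D0; exists D; split=> // x xL.
have /andP[c0 c1] := cutoff_itv L x L0 xL.
have f0 : 0 < f x by exact: expR_gt0.
have W0 := Wfac_gt0 u x.
have DE : D x = cutoff L x ^+ 2 * f x * Wfac u x -
    2 * cutoff L x * f x * (\sum_i Z i x * dcutoff L i x).
  transitivity (cutoff L x ^+ 2 * f x *
    (\sum_i Z i x * (b ord0 i + alpha * pd i u x) - \sum_i dZ i i x) -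
    2 * cutoff L x * f x * (\sum_i Z i x * dcutoff L i x)).
    rewrite -sumrB !mulr_sumr -sumrB; apply: eq_bigr => i _ /=; ring.
  by rewrite div_Z Z_dot_grad; ring.
rewrite DE lerD2l lerNr opprK.
have cf : 0 <= 2 * cutoff L x * f x by rewrite mulr_ge0 ?(ltW f0)// mulr_ge0.
have -> : 4 * n%:R * (n%:R + 2) / L * (f x * (cutoff L x * Wfac u x)) =
    2 * cutoff L x * f x * (((n%:R + 2) * Wfac u x * (2 / L)) *+ n).
  by rewrite -mulr_natl; ring.
apply: ler_wpM2l => //; apply: (le_trans (ler_norm _)); apply: norm_sum_le => i.
by rewrite normrM; apply: ler_pM => //; [exact: norm_Z_le|exact: norm_dcutoff_le].
Qed.

Hypothesis H0 : forall x, mean_curv u x <= 0.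

(** With [exp (- S)] pinched between positive constants, the main term of [soliton_div] has integral
    of order at least [L^n], while its error term is of order [L^(n-1)]. *)
Lemma soliton_unbounded (m : R) : alpha != 0 -> ~ (forall x, `|S x| <= m).
Proof.
move=> a0 Sm.
have m0 : 0 <= m by exact: le_trans (Sm 0).
have na0 : 0 < `|alpha| by rewrite normr_gt0.
(* On the cube, [|alpha| |u| <= |S| + n L <= (m + n) L] as soon as [L >= 1]; the final 1 makes [P0]
   positive in every case. *)
pose P0 := (m + n%:R) / `|alpha| + 1.
have P00 : 0 < P0 by rewrite ltr_wpDl// divr_ge0// addr_ge0.
(* The constant of [area_density_bound] for [P = L * P0], in which [L] cancels. *)
pose K := 1 + 2 * P0 * pi * 2 *+ n : R.
have K0 : 0 < K by rewrite ltr_wpDr// mulrn_wge0// !mulr_ge0// ?pi_ge0// ltW.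
pose c := 4 * n%:R * (n%:R + 2) : R.
have c0 : 0 <= c by rewrite !mulr_ge0// addr_ge0.
suff bound L : 1 <= L -> L * (expR (- m) * (8 / 15) ^+ n) <= c * expR m * K.
  have E0 : 0 < expR (- m) * (8 / 15) ^+ n by rewrite mulr_gt0 ?expR_gt0// exprn_gt0// divr_gt0.
  pose q := c * expR m * K / (expR (- m) * (8 / 15) ^+ n).
  have q0 : 0 <= q by rewrite divr_ge0 ?(ltW E0)// !mulr_ge0 ?expR_ge0// ltW.
  (* For [L = 1 + q] the bound reads [1 + q <= q]. *)
  have := bound (1 + q); rewrite lerDl q0 => /(_ isT).
  by rewrite -ler_pdivlMr// -/q; lra.
move=> L1.
have L0 : 0 < L by exact: lt_le_trans L1.
have P1 : 0 < L * P0 by rewrite mulr_gt0.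
have [DA [cDA DA0 _ DAW]] := area_density_bound u L (L * P0) su H0 L0 P1.
have KE : 1 + 2 * (L * P0) * pi * (2 / L *+ n) = K.
  by rewrite mulrnAr /K; congr (_ + _ *+ n); field; rewrite gt_eqF.
rewrite KE in DAW.
have [DB [cDB DB0 DBW]] := soliton_div L L0.
have uP x : inbox L x -> `|u x| <= L * P0.
  move=> xL; rewrite /P0 mulrDr mulr1 ler_wpDr ?(ltW L0)// mulrA ler_pdivlMr//.
  have -> : `|u x| * `|alpha| = `|S x - \sum_k b ord0 k * x ord0 k|.
    by rewrite -normrM /S addrAC subrr add0r mulrC.
  apply: (le_trans (ler_normB _ _)); rewrite mulrDr; apply: lerD.
    by apply: (le_trans (Sm x)); rewrite -[leLHS]mul1r ler_wpM2r.
  rewrite mulr_natr; apply: norm_sum_le => k.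
  by rewrite normrM -[leRHS]mul1r; apply: ler_pM => //; exact: norm_coeff_le1.
have [bD bZ ble bc] := boxintP L n (ltW L0).
have cc (z : R) : continuous (fun _ : 'rV[R]_n => z) by exact: rcontinuous_cst.
have ceta : continuous (fun x : 'rV[R]_n => \prod_i (hat L (x ord0 i) ^+ 2)).
  rewrite (_ : (fun _ => _) = fun x => cutoff L x * cutoff L x).
    by apply: rcontinuousM; case: (has_grad_cutoff (n := n) L).
  by apply/funext => x; rewrite prodrXl expr2.
(* Both zero-integral divergences are added in one pointwise comparison: [DB] supplies the main
   term, [DA] absorbs its error. *)
have : expR (- m) * boxint L n (fun x => \prod_i (hat L (x ord0 i) ^+ 2)) <=
   c / L * expR m * (K * (2 * L) ^+ n).
  have -> : c / L * expR m * (K * (2 * L) ^+ n) =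
      boxint L n (fun x => DB x + c / L * expR m * (K + DA x)).
    rewrite bD//; last by apply: rcontinuousM => //; exact: rcontinuousD.
    rewrite bZ; last exact: rcontinuousD.
    by rewrite bD// DA0 DB0 bc addr0 add0r.
  rewrite -bZ//; apply: ble.
  - exact: rcontinuousM.
  - by apply: rcontinuousD => //; apply: rcontinuousM => //; exact: rcontinuousD.
  move=> x xL; rewrite prodrXl -/(cutoff L x).
  have /andP[e0 e1] := cutoff_itv L x L0 xL.
  have W1 := Wfac_ge1 u x.
  have W0 := Wfac_gt0 u x.
  have := Sm x; rewrite ler_norml => /andP[Sm1 Sm2].
  have f1 : expR (- m) <= f x by rewrite ler_expR; lra.
  have f2 : f x <= expR m by rewrite ler_expR; lra.
  have cL : 0 <= c / L by rewrite divr_ge0// ltW.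
  have g1 : expR (- m) * cutoff L x ^+ 2 <= cutoff L x ^+ 2 * f x * Wfac u x.
    rewrite mulrC -[leLHS]mulr1; apply: ler_pM => //.
      by rewrite mulr_ge0 ?expR_ge0// sqr_ge0.
    by apply: ler_wpM2l => //; exact: sqr_ge0.
  have g2 : c / L * (f x * (cutoff L x * Wfac u x)) <= c / L * expR m * (K + DA x).
    rewrite -[leRHS]mulrA; apply: ler_wpM2l => //; apply: ler_pM => //.
    - exact: expR_ge0.
    - by rewrite mulr_ge0// ltW.
    - by apply: DAW => //; exact: uP.
  by have := DBW x xL; rewrite -/c; lra.
rewrite (boxint_prod L n (fun t => hat L t ^+ 2)) ?(ltW L0)//; last first.
  rewrite (_ : (fun _ => _) = fun t => hat L t * hat L t).
    by apply: rcontinuousM; exact: continuous_hat.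
  by apply/funext => t; rewrite expr2.
(* Expressed through the side [2 L], so that [(2 L)^n] cancels on both sides. *)
rewrite itv_int_sqr_hat// (_ : 16 / 15 * L = 8 / 15 * (2 * L)); last by ring.
rewrite [(8 / 15 * _) ^+ n]exprMn [leLHS]mulrA [leRHS]mulrA ler_pM2r; last first.
  by rewrite exprn_gt0// mulr_gt0.
have -> : c / L * expR m * K = c * expR m * K / L by ring.
by rewrite ler_pdivlMr// mulrC.
Qed.

Lemma soliton_height :
  (forall m : R, exists x, S x < m) \/ (forall m : R, exists x, m < S x).
Proof.
apply: contrapT => /not_orP[/existsNP[m1 /forallNP h1] /existsNP[m2 /forallNP h2]].
have h1' x : m1 <= S x by have /negP := h1 x; rewrite -leNgt.
have h2' x : S x <= m2 by have /negP := h2 x; rewrite -leNgt.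
have [a0|a0] := eqVneq alpha 0; last first.
  apply: (soliton_unbounded (Num.max (- m1) m2) a0) => x.
  by rewrite ler_norml lerNl !le_max h2' lerN2 h1' orbT.
(* For a horizontal [a] the height is linear with [|b| = 1], and it takes the value [m2 + 1] at this
   point. *)
have := h2' ((m2 + 1) *: b); rewrite /S a0 mul0r addr0.
have -> : \sum_k b ord0 k * ((m2 + 1) *: b) ord0 k = (m2 + 1) * dotp b b.
  by rewrite mulr_sumr; apply: eq_bigr => k _; rewrite mxE mulrCA.
have -> : dotp b b = 1 by rewrite -ab1 a0 expr0n addr0.
by lra.
Qed.

End Soliton.

(** * Both conclusions for the graph, with an arbitrary unit direction *)

Theorem theorem5 (R : realType) (n : nat) (u : 'rV[R]_n -> R) :
  smooth u ->
  (forall x, mean_curv u x <= 0) ->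
  (exists C : R, 0 < C /\
     forall r : R, 0 < r -> (graph_ball_vol u r <= (C * r ^+ n)%:E)%E) /\
  (forall a : 'rV[R]_(n + 1), dotp a a = 1 ->
     (forall x, mean_curv u x = dotp (normal u x) a) ->
     (forall m : R, exists x, dotp (graphpt u x) a < m) \/
     (forall m : R, exists x, m < dotp (graphpt u x) a)).
Proof.
move=> su H; split; first exact: graph_ball_vol_le.
(* The direction is split into its horizontal part and its last coordinate, the [b] and [alpha] of
   the soliton estimates. *)
move=> a; have -> : a = row_mx (lsubmx a) (rsubmx a ord0 ord0)%:M.
  rewrite -[LHS]hsubmxK; congr row_mx.
  by apply/matrixP => i j; rewrite !ord1 [RHS]mxE eqxx.
move: (lsubmx a) (rsubmx a ord0 ord0) => b alpha {a}.
rewrite dotp_row_mx -expr2 => ab1 Hs.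
have dotC x : dotp x b = \sum_k b ord0 k * x ord0 k.
  by apply: eq_bigr => k _; rewrite mulrC.
have := soliton_height u b alpha su ab1 _ H.
case=> [x|h|h].
- rewrite Hs /normal [LHS](_ : _ = (Wfac u x)^-1 * dotp (row_mx (- grad u x) 1%:M) (row_mx b alpha%:M)).
    rewrite dotp_row_mx mul1r mulrC; congr (_ * _); rewrite addrC; congr (_ + _).
    by rewrite dotC -sumrN; apply: eq_bigr => k _; rewrite !mxE mulrN.
  by rewrite /dotp mulr_sumr; apply: eq_bigr => k _; rewrite [in LHS]mxE mulrA.
- by left=> m; have [x xm] := h m; exists x; rewrite dotp_row_mx dotC [u x * _]mulrC.
- by right=> m; have [x xm] := h m; exists x; rewrite dotp_row_mx dotC [u x * _]mulrC.
Qed.
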